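(* Let $1\le p<\infty$, let $\Omega$ be a measure space, and let $\phi: S \rightarrow L^p(\Omega)$ be a disintegration, where $S\subseteq\mathbb{N}^*$ is a tree. (1) If $C \subseteq S$ is an almost norm-maximizing chain, then the $\preceq$-infimum of $\phi[C]$ exists and is either $\mathbf{0}$ or an atom of $\preceq$. Furthermore, $\inf\phi[C]$ is the limit in the $L^p$ norm of $\phi(\nu)$ as $\nu$ traverses the nodes of $C$ in increasing order. (2) If $\{C_n\}_{n=0}^\infty$ is a partition of $S$ into almost norm-maximizing chains, then the vectors $\inf\phi[C_0], \inf\phi[C_1], \ldots$ are (pairwise) disjointly supported. Furthermore, if $A$ is an atom of $\Omega$, then there exists a unique $n$ such that $A$ is the support of $\inf \phi[C_n]$.
   Context: $\mathbb{N}^*$ is the set of finite sequences of natural numbers, ordered by extension; a tree is a subset closed under initial segments. Vectors $f,g\in L^p(\Omega)$ are disjointly supported if their supports intersect in a null set ($f\cdot g=0$). $f$ is a subvector of $g$, written $f\preceq g$, if $f=g\cdot\chi_A$ for some measurable $A$; this is a partial order, and a $\preceq$-atom is a nonzero $f$ whose only subvectors are $\mathbf{0}$ and $f$ (equivalently, $\operatorname{supp}(f)$ is an atom of $\Omega$). An atom of $\Omega$ is a non-null measurable set $A$ with $\mu(B)=\mu(A)$ for all non-null measurable $B\subseteq A$. A map $\phi:S\to L^p(\Omega)$ is summative if for each nonterminal $\nu\in S$, $\phi(\nu)=\sum\phi(\nu')$ over the children $\nu'$ of $\nu$ in $S$; separating if $\phi(\nu),\phi(\nu')$ are disjointly supported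 whenever $\nu,\nu'$ are incomparable; a disintegration if it is injective, never zero, summative, separating, and its range has dense linear span. A non-root node $\nu\in S$ is an almost norm-maximizing child of its parent if $\|\phi(\nu')\|_p^p\le\|\phi(\nu)\|_p^p+2^{-|\nu|}$ for every sibling $\nu'\in S$ of $\nu$. A chain $C\subseteq S$ is almost norm-maximizing if for every $\nu\in C$ having a child in $S$, $C$ contains an almost norm-maximizing child of $\nu$.
   Formalization: In (2) the atom A of Ω is assumed to have finite measure: an atom of infinite measure is never the support of an L^p vector, so the claim fails for it. Chains are taken nonempty, since an empty family has in general no infimum. *)

(* Defs.v *)
From HB Require Import structures.
From mathcomp Require Import all_boot all_order all_algebra.
From mathcomp Require Import all_classical all_reals all_analysis.

Set Implicit Arguments.
Unset Strict Implicit.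
Unset Printing Implicit Defensive.

Import Order.TTheory GRing.Theory Num.Theory.
Import numFieldNormedType.Exports.

Local Open Scope classical_set_scope.
Local Open Scope ring_scope.

(* Nodes are elements of [seq nat] ordered by [prefix]; the children of [s]
   are the sequences [rcons s n]. *)
Definition is_tree (S : set (seq nat)) : Prop :=
  forall s t : seq nat, prefix s t -> S t -> S s.

Definition incomparable (s t : seq nat) : Prop :=
  ~~ prefix s t /\ ~~ prefix t s.

Definition nonterminal (S : set (seq nat)) (s : seq nat) : Prop :=
  exists n : nat, S (rcons s n).

(* Nonempty, since the infimum of the empty family does not exist in general. *)
Definition is_chain (S C : set (seq nat)) : Prop :=
  [/\ C !=set0, C `<=` S & total_on C (fun s t => prefix s t)].

Section AtomsOfMeasureSpace.
Context (d : measure_display) (T : measurableType d) (R : realType).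
Context (mu : {measure set T -> \bar R}).

Definition measure_atom (A : set T) : Prop :=
  [/\ measurable A, mu A != 0%E
    & forall B, measurable B -> B `<=` A -> mu B != 0%E -> mu B = mu A].

End AtomsOfMeasureSpace.

(* Elements of [LspaceType mu p1] are a.e.-equality classes, so that Leibniz
   equality is equality in L^p. Such a class coerces to a representative
   function, and everything below is insensitive to the representative. *)
Section Lp.
Context (d : measure_display) (T : measurableType d) (R : realType).
Context (mu : {measure set T -> \bar R}) (p : R) (p1 : (1 <= p%:E)%E).

Local Notation Lp := (LspaceType mu p1).

Definition Lp_norm (f : T -> R) : \bar R := 'N[mu]_(p%:E)[EFin \o f].

Definition Lp_supp (f : Lp) : set T := [set x | (f x : R) != 0].

(* The support is only defined up to a null set; [`+`] is the symmetric
   difference. *)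
Definition is_Lp_supp (A : set T) (f : Lp) : Prop :=
  mu (A `+` Lp_supp f) = 0%E.

Definition Lp_is0 (f : Lp) : Prop :=
  {ae mu, forall x, (f x : R) = 0}.

Definition disjointly_supported (f g : Lp) : Prop :=
  mu (Lp_supp f `&` Lp_supp g) = 0%E.

Definition subvector (f g : Lp) : Prop :=
  exists2 A : set T, measurable A &
    {ae mu, forall x, (f x : R) = (g x : R) * \1_A x}.

Definition subvector_atom (f : Lp) : Prop :=
  ~ Lp_is0 f /\ forall g : Lp, subvector g f -> Lp_is0 g \/ g = f.

Definition is_subvector_inf (E : set Lp) (f : Lp) : Prop :=
  (forall h, E h -> subvector f h) /\
  (forall g, (forall h, E h -> subvector g h) -> subvector g f).

Section Disintegrations.
Context (S : set (seq nat)) (phi : seq nat -> Lp).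

(* The children of a node are listed in increasing order of their last entry;
   for disjointly supported children the order is immaterial. *)
Definition summative : Prop :=
  forall s, S s -> nonterminal S s ->
    (fun N : nat => Lp_norm (fun x => (phi s x : R) -
       \sum_(n < N | rcons s n \in S) (phi (rcons s n) x : R)))
      @ \oo --> 0%E.

Definition separating : Prop :=
  forall s t, S s -> S t -> incomparable s t ->
    disjointly_supported (phi s) (phi t).

Definition dense_span : Prop :=
  forall (f : Lp) (e : R), 0 < e ->
    exists2 l : seq (R * seq nat),
      (forall a, a \in l -> S a.2) &
      (Lp_norm (fun x => (f x : R) - \sum_(a <- l) a.1 * (phi a.2 x : R))%R
         < e%:E)%E.

Definition disintegration : Prop :=
  [/\ set_inj S phi, forall s, S s -> ~ Lp_is0 (phi s),
      summative, separating & dense_span].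

(* The node in question is [rcons s n], of length [(size s).+1]. *)
Definition almost_norm_maximizing_child (s : seq nat) (n : nat) : Prop :=
  S (rcons s n) /\
  forall m : nat, S (rcons s m) ->
    (Lp_norm (phi (rcons s m)) `^ p <=
     Lp_norm (phi (rcons s n)) `^ p + (2^-1 ^+ size (rcons s n))%:E)%E.

Definition almost_norm_maximizing_chain (C : set (seq nat)) : Prop :=
  is_chain S C /\
  forall s, C s -> nonterminal S s ->
    exists2 n : nat, C (rcons s n) & almost_norm_maximizing_child s n.

(* Convergence in L^p norm of the net [phi] restricted to [C], the nodes of
   [C] being directed by extension. *)
Definition Lp_limit_along (C : set (seq nat)) (f : Lp) : Prop :=
  forall e : R, 0 < e ->
    exists2 s0, C s0 & forall s, C s -> prefix s0 s ->
      (Lp_norm (fun x => (phi s x : R) - (f x : R))%R < e%:E)%E.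

End Disintegrations.
End Lp.

(* Main.v *)
(* Off a single null set, the values at a point x of all the phi s behave as in
   the pointwise picture: along the branches they are constant until they
   become 0, and at most one of two incomparable nodes is nonzero.  The infimum
   along a chain is therefore the common value on the intersection of the
   supports.  Every phi s is a scalar multiple of it there, so density of the
   span leaves no room for a proper nonzero subvector.  Finally, the nodes whose
   support contains a given atom A of the measure space have p-masses bounded
   below by some r > 0; if no chain stayed among them, then almost
   norm-maximality would make some descendant of each of them lose a mass of
   r / 2 to a sibling, infinitely often. *)
Require Import Defs.
From mathcomp Require Import all_boot all_order all_algebra.
From mathcomp Require Import lra.
From mathcomp Require Import all_classical all_reals all_analysis.
From mathcomp Require Import measurable_realfun.

Set Implicit Arguments.
Unset Strict Implicit.
Unset Printing Implicit Defensive.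

Import Order.TTheory GRing.Theory Num.Theory.
Import numFieldNormedType.Exports.

Local Open Scope classical_set_scope.
Local Open Scope ring_scope.

(** * Chains in a tree of finite sequences *)

Section Chains.
Context (S : set (seq nat)).

(** What almost norm-maximality says once norms are forgotten. Maximality is meant upwards only:
    such a chain may begin at any node, continues without gaps, and ends only at a terminal node of
    [S]. *)
Definition maximal_chain (C : set (seq nat)) : Prop :=
  is_chain S C /\
  forall s, C s -> nonterminal S s -> exists n : nat, C (rcons s n).

Lemma comparable_or_incomparable (s t : seq nat) :
  [\/ prefix s t, prefix t s | incomparable s t].
Proof.
have [?|st] := boolP (prefix s t); first by constructor 1.
have [?|ts] := boolP (prefix t s); first by constructor 2.
by constructor 3.
Qed.

(** A chain has at most one node of each length, so passing from [k] to [k.+1] adds at most one node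
    [u], and the longer of [t] and [u] serves. This stands in for an enumeration of the chain when a
    limit is taken along it. *)
Lemma chain_cover (C : set (seq nat)) (k : nat) : is_chain S C ->
  exists2 t, C t & forall s, C s -> (size s <= k)%N -> prefix s t.
Proof.
move=> [[s0 Cs0] _ totC]; elim: k => [|k [t Ct tP]].
  exists s0 => // s _; rewrite leqn0 size_eq0 => /eqP ->; exact: prefix0s.
have [[u [Cu szu]]|none] := pselect (exists u, C u /\ size u = k.+1).
  have uP s : C s -> (size s <= k.+1)%N -> prefix s t \/ prefix s u.
    rewrite leq_eqVlt => Cs /orP[/eqP szs|]; last by move/(tP _ Cs); left.
    right; have [//|] := totC _ _ Cs Cu.
    by rewrite prefixE szu -szs take_size => /eqP ->; exact: prefix_refl.
  have [tu|ut] := totC _ _ Ct Cu.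
    exists u => // s Cs /(uP _ Cs)[] // st; exact: prefix_trans st tu.
  exists t => // s Cs /(uP _ Cs)[] // st; exact: prefix_trans st ut.
exists t => // s Cs; rewrite leq_eqVlt => /orP[/eqP szs|]; last exact: tP.
by case: none; exists s.
Qed.

Context (treeS : is_tree S).

(** As long as [t] is not reached, the current node has a child in [S], hence one in [C]. That child
    is comparable with [t], so it is the next node on the way to [t]. *)
Lemma chain_grow (C : set (seq nat)) (s t : seq nat) : maximal_chain C ->
  S t -> (forall u, C u -> prefix u t \/ prefix t u) ->
  C s -> prefix s t -> C t.
Proof.
move=> [_ maxC] St cmp Cs /prefixP[u tE]; subst t.
elim: u s St cmp Cs => [|a u IH] s St cmp Cs; first by rewrite cats0.
have Ssa : S (rcons s a).
  by apply: treeS St; rewrite -cat_rcons; exact: prefix_prefix.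
have [b Csb] := maxC s Cs (ex_intro _ a Ssa).
have ba : b = a.
  have := cmp _ Csb; rewrite -cats1 !prefix_catr// !prefix_cons.
  by rewrite !eqxx /=; case=> /andP[/eqP ->].
by subst b; rewrite -cat_rcons; apply: IH; rewrite ?cat_rcons.
Qed.

(** If both alternatives failed, every node of [C] would be a prefix of [t]; the chain would then
    grow up to [t] itself, which is a prefix of [t]. *)
Lemma chain_dichotomy (C : set (seq nat)) (t : seq nat) : maximal_chain C ->
  S t -> (exists2 s, C s & prefix t s) \/ (exists2 s, C s & incomparable t s).
Proof.
move=> maxC St; have [[s0 Cs0] _ _] := maxC.1.
have [?|noext] := pselect (exists2 s, C s & prefix t s); first by left.
have [?|noinc] := pselect (exists2 s, C s & incomparable t s); first by right.
have pre s : C s -> prefix s t.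
  move=> Cs; have [ts|//|ts] := comparable_or_incomparable t s.
    by case: noext; exists s.
  by case: noinc; exists s.
case: noext; exists t; last exact: prefix_refl.
by apply: (chain_grow maxC St _ Cs0 (pre _ Cs0)) => u /pre; left.
Qed.

(** If all nodes of [C] were comparable with all nodes of [D], then of two chosen nodes [s0] and
    [t0] the longer one would be reached by the other chain as well, and so lie in both. *)
Lemma disjoint_chains (C D : set (seq nat)) : maximal_chain C ->
  maximal_chain D -> C `&` D = set0 ->
  exists s t, [/\ C s, D t & incomparable s t].
Proof.
move=> maxC maxD CD0.
have CD s : C s -> D s -> False by move=> Cs Ds; rewrite -[False]/(set0 s) -CD0.
have [[s0 Cs0] CS _] := maxC.1; have [[t0 Dt0] DS _] := maxD.1.
have [//|noinc] := pselect (exists s t, [/\ C s, D t & incomparable s t]).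
have cmp s t : C s -> D t -> prefix s t \/ prefix t s.
  move=> Cs Dt; have [st|ts|st] := comparable_or_incomparable s t.
  - by left.
  - by right.
  - by case: noinc; exists s, t.
have [st|ts] := cmp _ _ Cs0 Dt0; exfalso.
  apply: (CD t0) => //; apply: (chain_grow maxC (DS _ Dt0) _ Cs0 st) => u Cu.
  exact: cmp.
apply: (CD s0) => //; apply: (chain_grow maxD (CS _ Cs0) _ Dt0 ts) => u Du.
by case: (cmp _ _ Cs0 Du); [right|left].
Qed.
End Chains.

(** * Integrals of p-th powers and elements of L^p *)

Section Disintegrations.
Context (d : measure_display) (T : measurableType d) (R : realType).
Context (mu : {measure set T -> \bar R}) (p : R) (p1 : (1 <= p%:E)%E).

Local Notation Lp := (LspaceType mu p1).

Definition pint (u : T -> R) : \bar R := (\int[mu]_x (`|u x| `^ p)%:E)%E.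

Let p_gt0 : 0 < p.
Proof. by apply: lt_le_trans (ltr01) _; rewrite -lee_fin. Qed.

Lemma Lp_norm_poweR (u : T -> R) : (Lp_norm mu p u `^ p)%E = pint u.
Proof. by rewrite /Lp_norm poweR_Lnorm// gt_eqF. Qed.

Lemma pint_ge0 (u : T -> R) : (0 <= pint u)%E.
Proof. by apply: integral_ge0 => x _; rewrite lee_fin powR_ge0. Qed.

Lemma Lp_norm_lt (u : T -> R) (e : R) : 0 < e ->
  (Lp_norm mu p u < e%:E)%E = (pint u < (e `^ p)%:E)%E.
Proof.
move=> e0; rewrite -Lp_norm_poweR.
have : (0 <= Lp_norm mu p u)%E by exact: Lnorm_ge0.
case: (Lp_norm mu p u) => [r| |] //= r0.
  rewrite !lte_fin; apply/idP/idP.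
    by apply: gt0_ltr_powR; rewrite ?nnegrE// ltW.
  rewrite !ltNge; apply: contra => er.
  by rewrite ge0_ler_powR// ?nnegrE// ltW.
by rewrite gt_eqF.
Qed.

Lemma measurable_Lp (f : Lp) : measurable_fun [set: T] (f : T -> R).
Proof. exact: (@measurable_funPT _ _ _ (measurableTypeR R) (repr (LebesgueSpace.sort f))). Qed.

Lemma measurable_pint (u : T -> R) : measurable_fun [set: T] u ->
  measurable_fun [set: T] (fun x => (`|u x| `^ p)%:E).
Proof.
move=> mu_; apply/measurable_EFinP.
apply: (measurableT_comp (measurable_powR _)) => //.
exact: measurableT_comp.
Qed.

Lemma pint_Lp (f : Lp) : (pint f < +oo)%E.
Proof.
rewrite -Lp_norm_poweR; apply: poweR_lty; exact: Lebesgue_finite.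
Qed.

Lemma pint_le (u v : T -> R) : measurable_fun [set: T] u ->
  measurable_fun [set: T] v -> {ae mu, forall x, `|u x| <= `|v x|} ->
  (pint u <= pint v)%E.
Proof.
move=> mu_ mv uv; apply: ae_ge0_le_integral => //;
  try exact: measurable_pint; try by move=> x _; rewrite lee_fin powR_ge0.
apply: filterS uv => x uvx _; rewrite lee_fin ge0_ler_powR// ?nnegrE//.
exact: ltW.
Qed.

(** The element is the class of [u] modulo a.e.-equality. Its chosen representative agrees with [u]
    only almost everywhere, which still bounds its integral and so makes its norm finite. *)
Lemma Lp_of_fun (u : T -> R) : measurable_fun [set: T] u ->
  (pint u < +oo)%E -> exists f : Lp, {ae mu, forall x, (f x : R) = u x}.
Proof.
move=> mu_ u_lty.
have mu_' : @measurable_fun _ _ T (measurableTypeR R) setT u by exact: mu_.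
pose um : {mfun T >-> measurableTypeR R} :=
  @mfun_Sub _ _ T (measurableTypeR R) u (mem_set mu_').
pose q : aeEqMfun (measurableTypeR R) mu := (\pi_(aeEqMfun (measurableTypeR R) mu) um)%qT.
have ae_um : {ae mu, forall x, (q x : R) = u x}.
  have : ae_eq_op mu (repr q) um by rewrite -eqmodE reprK.
  by move=> /asboolP; apply: filterS => x /(_ I).
have q_fin : finite_norm mu p%:E q.
  have : (pint q < +oo)%E.
    apply: le_lt_trans u_lty; apply: pint_le => //.
      exact: (@measurable_funPT _ _ _ (measurableTypeR R) (repr q)).
    by apply: filterS ae_um => x ->.
  by rewrite -Lp_norm_poweR => /lty_poweRy; apply; rewrite gt_eqF.
by exists (LebesgueSpace.Pack (LebesgueSpace.Class
  (isFinLebesgue.Build _ _ _ _ _ p1 q q_fin))).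
Qed.

(** An element is a class packed with a proof of finite norm: the classes agree by the quotient, the
    proofs because the condition is boolean. *)
Lemma Lp_ext (f g : Lp) : {ae mu, forall x, (f x : R) = g x} -> f = g.
Proof.
case: f g => [f [[ff]]] [g [[gf]]] /= fg.
have {}fg : f = g.
  rewrite -[f]reprK -[g]reprK; apply/eqP; rewrite eqmodE; apply/asboolP.
  by apply: filterS fg => x fgx _; exact: fgx.
by case: _ / fg gf => gf; congr (LebesgueSpace.Pack (LebesgueSpace.Class _));
  congr isFinLebesgue.phant_Build; exact: bool_irrelevance.
Qed.

Lemma pint_eq0 (u : T -> R) : measurable_fun [set: T] u ->
  pint u = 0%E -> {ae mu, forall x, u x = 0}.
Proof.
move=> mu_ u0.
have := (ae_eq_integral_abs mu measurableT (measurable_pint mu_)).1.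
under eq_integral do rewrite abse_EFin ger0_norm ?powR_ge0//.
move=> /(_ u0); apply: filterS => x /(_ I) [] /eqP.
by rewrite powR_eq0 normr_eq0 => /andP[/eqP].
Qed.

(** * Countable quantification, supports and masses *)

(** Applied with [J] the type of nodes: a single null set then serves all nodes at once. *)
Lemma ae_forall_countable (J : countType) (P : J -> T -> Prop) :
  (forall i, {ae mu, forall x, P i x}) -> {ae mu, forall x, forall i, P i x}.
Proof.
move=> Pae.
have : {ae mu, forall x, forall n, forall i, unpickle n = Some i -> P i x}.
  apply: ae_foralln => n; case: (unpickle n) => [i|]; last exact: aeW.
  by apply: filterS (Pae i) => x Pix j [<-].
by apply: filterS => x Px i; apply: (Px (pickle i)); rewrite pickleK.
Qed.

Lemma measurable_forall_countable (J : countType) (F : J -> set T) :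
  (forall i, measurable (F i)) -> measurable [set x | forall i, F i x].
Proof.
move=> mF; rewrite [X in measurable X](_ : _ =
  \bigcap_n (if unpickle n is Some i then F i else setT)).
  by apply: bigcapT_measurable => n; case: unpickle.
apply/seteqP; split => x /= Fx.
  by move=> n _; case: (unpickle n).
by move=> i; have := Fx (pickle i) I; rewrite pickleK.
Qed.

Lemma measure0_aeP (A : set T) : measurable A ->
  mu A = 0%E <-> {ae mu, forall x, ~ A x}.
Proof.
move=> mA; rewrite -(negligibleP mu mA); split; apply: negligibleS => x /=.
  exact: contrapT.
by move=> Ax; apply.
Qed.

Lemma measurable_Lp_supp (f : Lp) : measurable (Lp_supp f).
Proof.
rewrite (_ : Lp_supp f = ~` ((f : T -> R) @^-1` [set 0])).
  by apply: measurableC; rewrite -[X in measurable X]setTI; exact: measurable_Lp.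
by apply/seteqP; split => x /= /eqP.
Qed.

Lemma disjointly_supportedP (f g : Lp) : disjointly_supported f g <->
  {ae mu, forall x, (f x : R) = 0 \/ (g x : R) = 0}.
Proof.
rewrite /disjointly_supported measure0_aeP; last first.
  by apply: measurableI; exact: measurable_Lp_supp.
split; apply: filterS => x.
  by move=> /not_andP[] /negP; rewrite negbK => /eqP; [left|right].
by move=> [] fx []; rewrite /Lp_supp /= fx eqxx.
Qed.

(** Real-valued, since the integral is finite on L^p; this opens masses to linear arithmetic. *)
Definition Lp_mass (f : Lp) : R := fine (pint f).

Lemma Lp_massE (f : Lp) : pint f = (Lp_mass f)%:E.
Proof. by rewrite fineK// ge0_fin_numE ?pint_ge0 ?pint_Lp. Qed.

Lemma Lp_mass_ge0 (f : Lp) : 0 <= Lp_mass f.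
Proof. exact/fine_ge0/pint_ge0. Qed.

(* Masses of different nodes are not to be compared by unfolding integrals. *)
#[local] Opaque Lp_mass.

Lemma Lp_mass_eq0 (f : Lp) : Lp_mass f = 0 -> Lp_is0 f.
Proof.
by move=> f0; apply: (pint_eq0 (measurable_Lp f)); rewrite Lp_massE f0.
Qed.

Lemma Lp_mass_le (f g : Lp) : {ae mu, forall x, `|f x : R| <= `|g x : R|} ->
  Lp_mass f <= Lp_mass g.
Proof.
move=> fg; have := pint_le (measurable_Lp f) (measurable_Lp g) fg.
by rewrite (Lp_massE f) (Lp_massE g) lee_fin.
Qed.

Lemma Lp_mass_add_le (f g h : Lp) :
  {ae mu, forall x, `|f x : R| `^ p + `|g x : R| `^ p <= `|h x : R| `^ p} ->
  Lp_mass f + Lp_mass g <= Lp_mass h.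
Proof.
move=> fgh; have mp (k : Lp) := measurable_pint (measurable_Lp k).
have p0 (k : Lp) x : (0 <= (`|k x : R| `^ p)%:E)%E by rewrite lee_fin powR_ge0.
suff : (pint f + pint g <= pint h)%E.
  by rewrite (Lp_massE f) (Lp_massE g) (Lp_massE h) -EFinD lee_fin.
rewrite -(ge0_integralD mu measurableT (fun x _ => p0 f x) (mp f)
  (fun x _ => p0 g x) (mp g)).
apply: (ae_ge0_le_integral measurableT _ _ (fun x _ => p0 h x) (mp h)).
- by move=> x _; rewrite adde_ge0.
- exact: emeasurable_funD.
by apply: filterS fgh => x H _; rewrite -EFinD lee_fin.
Qed.

(* The witness w is in practice the error of an approximation in norm, which
   dominates v on the set where the approximant is known. *)
Lemma small_ae0 (v : T -> R) : measurable_fun [set: T] v ->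
  (forall e : R, 0 < e -> exists w : T -> R,
    [/\ measurable_fun [set: T] w, {ae mu, forall x, `|v x| <= `|w x|}
      & (Lp_norm mu p w < e%:E)%E]) ->
  {ae mu, forall x, v x = 0}.
Proof.
move=> mv small; apply: (pint_eq0 mv); apply/eqP.
rewrite eq_le pint_ge0 andbT leNgt; apply/negP => v0.
(* The integral of [v] may be infinite, so a finite positive lower bound [r] replaces it; the
   tolerance is the p-th root of [r]. *)
have [r r0 rv] : exists2 r : R, 0 < r & (r%:E <= pint v)%E.
  move: v0; case: (pint v) => [r| |] //; first by rewrite lte_fin; exists r.
  by exists 1; rewrite ?leey.
have er : (r `^ p^-1) `^ p = r.
  by rewrite -powRrM mulVf ?gt_eqF// powRr1// ltW.
have e0 : 0 < r `^ p^-1 by exact: powR_gt0.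
have [w [mw vw]] := small _ e0.
rewrite Lp_norm_lt// er ltNge => /negP; apply.
by apply: le_trans rv _; exact: pint_le.
Qed.

Lemma measurable_sum_cond (N : nat) (P : pred nat) (h : nat -> T -> R) :
  (forall n, measurable_fun [set: T] (h n)) ->
  measurable_fun [set: T] (fun x => \sum_(n < N | P n) h n x).
Proof.
move=> mh; under eq_fun do rewrite big_mkcond.
by apply: measurable_sum => n; case: (P n).
Qed.

(** * Pointwise behaviour of a disintegration *)

Context (S : set (seq nat)) (phi : seq nat -> Lp).

Lemma measurable_span (l : seq (R * seq nat)) :
  measurable_fun [set: T] (fun x => \sum_(a <- l) a.1 * (phi a.2 x : R)).
Proof.
apply: measurable_sum => a; apply: measurable_funM => //; exact: measurable_Lp.
Qed.

Lemma measurable_partial_sum (s : seq nat) (N : nat) :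
  measurable_fun [set: T]
    (fun x => \sum_(n < N | rcons s n \in S) (phi (rcons s n) x : R)).
Proof.
apply: (@measurable_sum_cond N (fun n => rcons s n \in S)
  (fun n => phi (rcons s n))) => n.
exact: measurable_Lp.
Qed.

Definition good_point (x : T) : Prop := forall s t, S s -> S t ->
  (prefix s t -> (phi t x : R) != 0 -> (phi s x : R) = phi t x) /\
  (incomparable s t -> (phi s x : R) = 0 \/ (phi t x : R) = 0).

Context (treeS : is_tree S) (disint : disintegration S phi).

(** The bound [n < N] ensures that the given child occurs in the partial sum. *)
Lemma summative_approx (s : seq nat) (n : nat) (e : R) : S (rcons s n) ->
  0 < e -> exists2 N : nat, (n < N)%N &
    (Lp_norm mu p (fun x => (phi s x : R) -
       \sum_(n < N | rcons s n \in S) (phi (rcons s n) x : R))%R < e%:E)%E.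
Proof.
case: disint => _ _ summ _ _ Ssn e0.
have Ss : S s by apply: treeS Ssn; exact: prefix_rcons.
have /(_ (ex_intro _ n Ssn)) := summ s Ss.
move=> /(_ [set y | (y < e%:E)%E]) [|M _ HM].
  by apply: open_nbhs_nbhs; split; [exact: open_ereal_lt_ereal|rewrite /= lte_fin].
exists (maxn M n.+1); first by rewrite leq_maxr.
by apply: HM; rewrite /= leq_maxl.
Qed.

Lemma incomparable_rcons (s : seq nat) (m n : nat) : m != n ->
  incomparable (rcons s m) (rcons s n).
Proof.
move=> mn; suff H a b : a != b -> ~~ prefix (rcons s a) (rcons s b).
  by split; apply: H; rewrite // eq_sym.
apply: contra; rewrite prefixE size_rcons -(size_rcons s b) take_size.
by rewrite eqseq_rcons eqxx eq_sym.
Qed.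

(** On the support of the child all its siblings vanish, so a partial sum containing the child
    equals it there. The difference of parent and child on this set is therefore dominated by the
    error of the partial sum, which is arbitrarily small. *)
Lemma ae_child (s : seq nat) (n : nat) : S (rcons s n) ->
  {ae mu, forall x, (phi (rcons s n) x : R) != 0 ->
                    (phi s x : R) = phi (rcons s n) x}.
Proof.
move=> Ssn; have [_ _ _ sep _] := disint.
pose A := Lp_supp (phi (rcons s n)).
pose v x := ((phi s x : R) - phi (rcons s n) x) * \1_A x.
have mv : measurable_fun [set: T] v.
  apply: measurable_funM.
    apply: measurable_funB; exact: measurable_Lp.
  by apply: measurable_indic; exact: measurable_Lp_supp.
suff : {ae mu, forall x, v x = 0}.
  apply: filterS => x vx phix0; move: vx; rewrite /v indicE mem_set// mulr1.
  by move/eqP; rewrite subr_eq0 => /eqP.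
apply: small_ae0 => // e e0.
have [N nN small] := summative_approx Ssn e0.
eexists; split; last exact: small.
  apply: measurable_funB; first exact: measurable_Lp.
  exact: measurable_partial_sum.
have : {ae mu, forall x, forall m, m != n -> S (rcons s m) ->
    (phi (rcons s m) x : R) = 0 \/ (phi (rcons s n) x : R) = 0}.
  apply: ae_foralln => m.
  have [mn|mn] := eqVneq m n; first by apply: aeW.
  have [Ssm|Ssm] := pselect (S (rcons s m)); last by apply: aeW => x _ /Ssm.
  have /disjointly_supportedP := sep _ _ Ssm Ssn (incomparable_rcons s mn).
  exact: filterS.
apply: filterS => x disj.
rewrite /v indicE; have [xA|xA] := boolP (x \in A); last by rewrite mulr0 normr0.
rewrite mulr1 (bigD1 (Ordinal nN))/=; last by rewrite inE.
rewrite big1 ?addr0// => m /andP[/set_mem Sm mn].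
by case: (disj m mn Sm) => // /eqP; move/set_mem: xA => /negPf ->.
Qed.

Lemma prefix_rconsE (s t : seq nat) (n : nat) :
  prefix s (rcons t n) = (s == rcons t n) || prefix s t.
Proof.
apply/idP/orP => [/prefixP[u]|[/eqP ->|st]]; last 2 first.
- exact: prefix_refl.
- exact: prefix_trans st (prefix_rcons _ _).
elim/last_ind: u => [|u m _]; first by rewrite cats0 => ->; left.
by rewrite -rcons_cat => /rcons_inj[-> _]; right; exact: prefix_prefix.
Qed.

Lemma ae_prefix (s t : seq nat) : S t -> prefix s t ->
  {ae mu, forall x, (phi t x : R) != 0 -> (phi s x : R) = phi t x}.
Proof.
elim/last_ind: t s => [|t n IH] s St.
  by rewrite prefixs0 => /eqP ->; apply: aeW.
rewrite prefix_rconsE => /orP[/eqP ->|st]; first by apply: aeW.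
have := ae_child St; apply: filterS2 (IH s (treeS (prefix_rcons _ _) St) st).
by move=> x H1 H2 tn0; rewrite H1 H2.
Qed.

Lemma ae_good_point : {ae mu, forall x, good_point x}.
Proof.
have [_ _ _ sep _] := disint.
apply: ae_forall_countable => s; apply: ae_forall_countable => t.
have [Ss|Ss] := pselect (S s); last by apply: aeW => x /Ss.
have [St|St] := pselect (S t); last by apply: aeW => x _ /St.
have pre : {ae mu, forall x, prefix s t -> (phi t x : R) != 0 ->
    (phi s x : R) = phi t x}.
  have [st|st] := boolP (prefix s t); last by apply: aeW.
  by apply: filterS (ae_prefix St st) => x xst _.
have inc : {ae mu, forall x, incomparable s t ->
    (phi s x : R) = 0 \/ (phi t x : R) = 0}.
  have [st|st] := pselect (incomparable s t); last by apply: aeW.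
  have /disjointly_supportedP := sep _ _ Ss St st.
  by apply: filterS => x xst _.
by apply: filterS2 inc pre => x ? ? _ _; split.
Qed.

(** * Subvectors, and the limit along a chain *)

Lemma subvector_anti (f g : Lp) : subvector f g -> subvector g f -> f = g.
Proof.
move=> [A _ fg] [B _ gf]; apply: Lp_ext; apply: filterS2 fg gf => x fx gx.
move: fx gx; rewrite !indicE; case: (x \in A); rewrite ?mulr1// mulr0 => ->.
by rewrite mul0r.
Qed.

Lemma subvector_inf_unique (E : set Lp) (f g : Lp) :
  is_subvector_inf E f -> is_subvector_inf E g -> f = g.
Proof.
by move=> [f1 f2] [g1 g2]; apply: subvector_anti; [apply: g2|apply: f2].
Qed.

Lemma restrict_Lp (g : Lp) (A : set T) : measurable A ->
  exists f : Lp, {ae mu, forall x, (f x : R) = (g x : R) * \1_A x}.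
Proof.
move=> mA.
have mgA : measurable_fun [set: T] (fun x => (g x : R) * \1_A x).
  by apply: measurable_funM; [exact: measurable_Lp|exact: measurable_indic].
apply: Lp_of_fun => //; apply: le_lt_trans (pint_Lp g).
apply: pint_le => //; first exact: measurable_Lp.
apply: aeW => x; rewrite indicE; case: (x \in A); rewrite ?mulr1// mulr0.
by rewrite normr0.
Qed.

Definition common_supp (C : set (seq nat)) : set T :=
  [set x | forall s, C s -> (phi s x : R) != 0].

Lemma measurable_common_supp (C : set (seq nat)) :
  measurable (common_supp C).
Proof.
apply: measurable_forall_countable => s.
have [Cs|Cs] := pselect (C s).
  rewrite [X in measurable X](_ : _ = Lp_supp (phi s)).
    exact: measurable_Lp_supp.
  by apply/seteqP; split => x //=; exact.
rewrite [X in measurable X](_ : _ = setT)//.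
by apply/seteqP; split => x.
Qed.

Lemma notin_common_supp (C : set (seq nat)) (x : T) : ~ common_supp C x ->
  exists2 s, C s & (phi s x : R) = 0.
Proof.
move=> Dx; have [//|no] := pselect (exists2 s, C s & (phi s x : R) = 0).
by case: Dx => s Cs; apply/eqP => phis0; apply: no; exists s.
Qed.

(** The pointwise form of the infimum along [C], from which the order property, the convergence in
    norm and the atomicity are all derived. *)
Definition is_chain_limit (C : set (seq nat)) (f : Lp) : Prop :=
  {ae mu, forall x,
    (common_supp C x -> forall s, C s -> (f x : R) = phi s x) /\
    (~ common_supp C x -> (f x : R) = 0)}.

Lemma chain_limit_exists (C : set (seq nat)) : is_chain S C ->
  exists f : Lp, is_chain_limit C f.
Proof.
move=> [[s0 Cs0] CS totC].
have [f fE] := restrict_Lp (phi s0) (measurable_common_supp C).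
exists f; apply: filterS2 fE ae_good_point => x fx gx.
rewrite fx indicE; split => [Dx s Cs|Dx]; last first.
  by rewrite memNset// mulr0.
rewrite mem_set// mulr1; have [s0s|ss0] := totC _ _ Cs0 Cs.
  exact: (gx _ _ (CS _ Cs0) (CS _ Cs)).1 s0s (Dx _ Cs).
by rewrite ((gx _ _ (CS _ Cs) (CS _ Cs0)).1 ss0 (Dx _ Cs0)).
Qed.

(** A common lower bound [g] vanishes wherever some node of [C] does, hence off the common support,
    where [f] is zero too. On the common support [f] agrees with [phi s0], so a set that cuts [g]
    out of [phi s0] also cuts it out of [f]. *)
Lemma chain_limit_inf (C : set (seq nat)) (f : Lp) : is_chain S C ->
  is_chain_limit C f -> is_subvector_inf (phi @` C) f.
Proof.
move=> [[s0 Cs0] CS totC] limf; split.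
  move=> _ [s Cs <-]; exists (common_supp C); first exact: measurable_common_supp.
  apply: filterS limf => x [fD fnD]; rewrite indicE.
  have [Dx|Dx] := pselect (common_supp C x).
    by rewrite mem_set// mulr1 (fD Dx _ Cs).
  by rewrite memNset// mulr0 fnD.
move=> g gsub.
have /choice[A AP] : forall s, exists A : set T, C s -> measurable A /\
    {ae mu, forall x, (g x : R) = (phi s x : R) * \1_A x}.
  move=> s; have [Cs|nCs] := pselect (C s); last by exists set0.
  by have [A mA gA] := gsub (phi s) (ex_intro2 _ _ s Cs erefl); exists A.
exists (A s0); first exact: (AP _ Cs0).1.
have : {ae mu, forall x s, C s -> (g x : R) = (phi s x : R) * \1_(A s) x}.
  apply: ae_forall_countable => s.
  have [Cs|nCs] := pselect (C s); last by apply: aeW.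
  by apply: filterS (AP _ Cs).2.
apply: filterS2 limf => x [fD fnD] gx.
have [Dx|Dx] := pselect (common_supp C x); first by rewrite (fD Dx _ Cs0) (gx _ Cs0).
rewrite fnD// mul0r.
have [s Cs phis0] := notin_common_supp Dx.
by rewrite (gx _ Cs) phis0 mul0r.
Qed.

(** By uniqueness of infima, one that is known only by its order property can be handled
    pointwise. *)
Lemma subvector_inf_chain_limit (C : set (seq nat)) (f : Lp) : is_chain S C ->
  is_subvector_inf (phi @` C) f -> is_chain_limit C f.
Proof.
move=> chC inff; have [g limg] := chain_limit_exists chC.
by rewrite (subvector_inf_unique inff (chain_limit_inf chC limg)).
Qed.

Lemma chain_limit_Lp_limit (C : set (seq nat)) (f : Lp) : is_chain S C ->
  is_chain_limit C f -> Lp_limit_along phi C f.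
Proof.
move=> chC limf e e0; have [[s0 Cs0] CS totC] := chC.
(* The sets [E k] decrease to the common support. Hence [u k] tends to zero pointwise, and its
   integral does so by dominated convergence, with [phi s0] as the bound. Far enough along [C], the
   error of [phi s] is at most [u k]. *)
pose E k := common_supp [set s | C s /\ (size s <= k)%N].
pose u k x := (phi s0 x : R) * \1_(E k `\` common_supp C) x.
have mu_ k : measurable_fun [set: T] (u k).
  apply: measurable_funM; first exact: measurable_Lp.
  apply: measurable_indic; apply: measurableD; exact: measurable_common_supp.
have u0 : (fun k => pint (u k)) @ \oo --> 0%E.
  rewrite -(integral0 mu [set: T]).
  apply: (@dominated_cvg _ _ _ mu _ measurableT _ _
      (fun x => (`|phi s0 x : R| `^ p)%:E)) => //.
  - by move=> k; exact: measurable_pint.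
  - move=> x _; apply: cvg_near_cst.
    have uk0 k : ~ (E k `\` common_supp C) x -> (`|u k x| `^ p)%:E = 0%E.
      by move=> nEx; rewrite /u indicE memNset// mulr0 normr0 powR0// gt_eqF.
    have [Dx|Dx] := pselect (common_supp C x).
      by apply: nearW => k; apply: uk0 => -[].
    have [s Cs phis0] := notin_common_supp Dx.
    exists (size s) => // k szs; apply: uk0 => -[Ex _].
    by have := Ex s (conj Cs szs); rewrite phis0 eqxx.
  - apply/integrableP; split; first by apply: measurable_pint; exact: measurable_Lp.
    under eq_integral do rewrite abse_EFin ger0_norm ?powR_ge0//.
    exact: pint_Lp.
  - move=> k x _; rewrite abse_EFin lee_fin ger0_norm ?powR_ge0//.
    rewrite ge0_ler_powR ?nnegrE ?(ltW p_gt0)// /u indicE normrM.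
    by case: (_ \in _); rewrite ?normr1 ?normr0 ?mulr1 ?mulr0.
have [k uk] : exists k, (pint (u k) < (e `^ p)%:E)%E.
  have [|M _ HM] := u0 [set y | (y < (e `^ p)%:E)%E].
    by apply: open_nbhs_nbhs; split;
      [exact: open_ereal_lt_ereal|rewrite /= lte_fin powR_gt0].
  by exists M; exact: HM (leqnn M).
(* The maximum makes [t] extend [s0] as well, so that [phi s] agrees with [phi s0] where it is
   nonzero. *)
have [t Ct tP] := chain_cover (maxn k (size s0)) chC.
exists t => // s Cs ts; rewrite (Lp_norm_lt _ e0); apply: le_lt_trans uk.
apply: pint_le => //.
  by apply: measurable_funB; exact: measurable_Lp.
apply: filterS2 limf ae_good_point => x [fD fnD] gx.
have [Dx|Dx] := pselect (common_supp C x).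
  by rewrite (fD Dx _ Cs) subrr normr0.
rewrite fnD// subr0; have [->|phis0] := eqVneq (phi s x : R) 0.
  by rewrite normr0.
have Ex : E k x.
  move=> s' [Cs' szs'].
  have s's : prefix s' s.
    by apply: prefix_trans ts; apply: tP; rewrite // leq_max szs'.
  by rewrite ((gx _ _ (CS _ Cs') (CS _ Cs)).1 s's).
rewrite /u indicE mem_set// mulr1.
rewrite ((gx _ _ (CS _ Cs0) (CS _ Cs)).1 _ phis0)//.
by apply: prefix_trans ts; apply: tP; rewrite // leq_max leqnn orbT.
Qed.

(** * Infima along chains that end only at terminal nodes *)

Lemma chain_limit_atom (C : set (seq nat)) (f : Lp) : maximal_chain S C ->
  is_chain_limit C f -> Lp_is0 f \/ subvector_atom f.
Proof.
move=> maxC limf; have [chC _] := maxC; have [_ CS _] := chC.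
have [f0|f_neq0] := pselect (Lp_is0 f); [by left|right; split => // g].
move=> [A mA gA].
(* On the support of f a linear combination of the phi s is k * f, with k a
   constant; as an approximation of g it has an error of at least |f| / 2
   either where g = f or where g = 0. *)
pose c s : R := if `[< exists2 t, C t & prefix s t >] then 1 else 0.
have phiE : {ae mu, forall x, common_supp C x ->
    forall s, S s -> (phi s x : R) = c s * f x}.
  apply: filterS2 limf ae_good_point => x [fD _] gx Dx s Ss.
  rewrite /c; case: asboolP => [[t Ct st]|no].
    by rewrite mul1r (fD Dx _ Ct) ((gx _ _ Ss (CS _ Ct)).1 st (Dx _ Ct)).
  rewrite mul0r; have [//|[t Ct st]] := chain_dichotomy treeS maxC Ss.
  by case: ((gx _ _ Ss (CS _ Ct)).2 st) => // /eqP; rewrite (negPf (Dx _ Ct)).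
(* Unless [g] is zero, [small_ae0] gives a positive lower bound [e1] for the norm of every
   measurable function dominating [g] / 2; [e2] does the same for [f - g]. An approximation of [g]
   within both bounds is then contradictory. *)
have [[e1 [e1_gt0 small1]]|g0] := pselect (exists e : R, 0 < e /\
    forall w : T -> R, measurable_fun [set: T] w ->
      {ae mu, forall x, `|2^-1 * (g x : R)| <= `|w x|} ->
      (e%:E <= Lp_norm mu p w)%E); last first.
  left; rewrite /Lp_is0.
  have : {ae mu, forall x, 2^-1 * (g x : R) = 0}.
    apply: small_ae0; first by apply: measurable_funM => //; exact: measurable_Lp.
    move=> e e0; apply/not_existsP => no; apply: g0; exists e; split=> // w mw gw.
    by rewrite leNgt; apply/negP => we; apply: (no w).
  apply: filterS => x /eqP; rewrite mulf_eq0 invr_eq0 pnatr_eq0/= => /eqP //.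
have [[e2 [e2_gt0 small2]]|h0] := pselect (exists e : R, 0 < e /\
    forall w : T -> R, measurable_fun [set: T] w ->
      {ae mu, forall x, `|2^-1 * ((f x : R) - g x)| <= `|w x|} ->
      (e%:E <= Lp_norm mu p w)%E); last first.
  right; apply: Lp_ext.
  have : {ae mu, forall x, 2^-1 * ((f x : R) - g x) = 0}.
    apply: small_ae0.
      apply: measurable_funM => //; apply: measurable_funB; exact: measurable_Lp.
    move=> e e0; apply/not_existsP => no; apply: h0; exists e; split=> // w mw gw.
    by rewrite leNgt; apply/negP => we; apply: (no w).
  apply: filterS => x /eqP; rewrite mulf_eq0 invr_eq0 pnatr_eq0/= subr_eq0.
  by move/eqP.
exfalso; have [_ _ _ _ dense] := disint.
have e_gt0 : 0 < Num.min e1 e2 by rewrite lt_min e1_gt0.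
have [l lS gl] := dense g _ e_gt0.
pose w x := (g x : R) - \sum_(a <- l) a.1 * (phi a.2 x : R).
have mw : measurable_fun [set: T] w.
  by apply: measurable_funB; [exact: measurable_Lp|exact: measurable_span].
pose k := \sum_(a <- l) a.1 * c a.2.
have wE : {ae mu, forall x,
    [/\ common_supp C x, g x = f x & w x = (1 - k) * f x] \/
    [/\ common_supp C x, (g x : R) = 0 & w x = - k * f x] \/
    ((f x : R) = 0 /\ (g x : R) = 0)}.
  apply: filterS3 limf phiE gA => x [fD fnD] phix gx.
  have [Dx|Dx] := pselect (common_supp C x); last first.
    by right; right; rewrite gx fnD// mul0r.
  have spanE : \sum_(a <- l) a.1 * (phi a.2 x : R) = k * f x.
    rewrite /k mulr_suml; apply: eq_big_seq => a /lS Sa.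
    by rewrite (phix Dx _ Sa) mulrA.
  move: gx; rewrite /w spanE indicE; case: (x \in A); rewrite ?mulr1 ?mulr0 => gx.
    by left; split; rewrite // gx mulrBl mul1r.
  by right; left; split; rewrite // gx sub0r mulNr.
have half : 2^-1 <= `|1 - k| \/ 2^-1 <= `|k|.
  have [?|k1] := leP 2^-1 `|1 - k|; first by left.
  have [?|k2] := leP 2^-1 `|k|; first by right.
  have : `|(1 - k) + k| < 2^-1 + 2^-1.
    by apply: le_lt_trans (ler_normD _ _) _; exact: ltrD.
  by rewrite subrK normr1 -mulr2n -[_ *+ 2]mulr_natr mulVf ?ltxx// pnatr_eq0.
move: gl; rewrite ltNge => /negP; apply.
have [k1|k2] := half.
  apply: le_trans (small1 w mw _); first by rewrite lee_fin ge_min lexx.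
  apply: filterS wE => x [[_ -> ->]|[[_ -> _]|[_ ->]]]; rewrite ?mulr0 ?normr0//.
  by rewrite !normrM ler_wpM2r// ger0_norm.
apply: le_trans (small2 w mw _); first by rewrite lee_fin ge_min lexx orbT.
apply: filterS wE => x [[_ -> _]|[[_ -> ->]|[-> ->]]];
  rewrite ?subrr ?mulr0 ?normr0// subr0.
by rewrite !normrM normrN ler_wpM2r// ger0_norm.
Qed.

Lemma almost_norm_maximizing_maximal (C : set (seq nat)) :
  almost_norm_maximizing_chain S phi C -> maximal_chain S C.
Proof.
by move=> [chC maxC]; split=> // s Cs /(maxC s Cs)[n Csn _]; exists n.
Qed.

(** The chains contain incomparable nodes, and the infima are subvectors of the disjointly supported
    vectors at these nodes. *)
Lemma subvector_inf_disjoint (C D : set (seq nat)) (f g : Lp) :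
  maximal_chain S C -> maximal_chain S D -> C `&` D = set0 ->
  is_subvector_inf (phi @` C) f -> is_subvector_inf (phi @` D) g ->
  disjointly_supported f g.
Proof.
move=> maxC maxD CD0 [fC _] [gD _].
have [s [t [Cs Dt st]]] := disjoint_chains treeS maxC maxD CD0.
have [_ CS _] := maxC.1; have [_ DS _] := maxD.1.
have [_ _ _ sep _] := disint; apply/disjointly_supportedP.
have /disjointly_supportedP := sep _ _ (CS _ Cs) (DS _ Dt) st.
have [A _ fs] := fC _ (ex_intro2 _ _ s Cs erefl).
have [B _ gt] := gD _ (ex_intro2 _ _ t Dt erefl).
by apply: filterS3 fs gt => x -> -> []->; rewrite mul0r; [left|right].
Qed.

(** * An atom of the measure space and the nodes that are nonzero on it *)

Context (A : set T) (atomA : measure_atom mu A) (A_fin : (mu A < +oo)%E).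

Let mA : measurable A. Proof. by case: atomA. Qed.

Lemma atom_not_null : ~ {ae mu, forall x, ~ A x}.
Proof.
move=> A0; have [_ /eqP + _] := atomA; apply; exact/measure0_aeP.
Qed.

Definition full_on_atom (f : T -> R) : Prop := {ae mu, forall x, A x -> f x != 0}.

(** If the support of [f] meets [A] in a non-null set, this set has the measure of [A]; since that
    measure is finite, subtraction shows that the rest of [A] is null. *)
Lemma atom_dichotomy (f : Lp) :
  {ae mu, forall x, A x -> (f x : R) = 0} \/ full_on_atom f.
Proof.
have mf := measurable_Lp_supp f.
have [f0|f_neq0] := eqVneq (mu (A `&` Lp_supp f)) 0%E; [left|right].
  move/measure0_aeP: f0 => /(_ (measurableI _ _ mA mf)).
  by apply: filterS => x fx Ax; apply: contra_notP fx => /eqP.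
have [_ _ /(_ (A `&` Lp_supp f))] := atomA.
move=> /(_ (measurableI _ _ mA mf) (@subIsetl _ _ _) f_neq0) muE.
have : mu (A `\` Lp_supp f) = 0%E.
  rewrite measureD//; transitivity (mu A - mu A)%E; first by congr (_ - _)%E.
  by rewrite subee// ge0_fin_numE.
move/measure0_aeP => /(_ (measurableD mA mf)).
by apply: filterS => x fx Ax; apply: contra_notT fx => fx; split=> //; exact/negP.
Qed.

Lemma full_on_atom_not0 (f : T -> R) : full_on_atom f ->
  ~ {ae mu, forall x, A x -> f x = 0}.
Proof.
move=> full f0; apply: atom_not_null; apply: filterS2 full f0 => x H1 H2 Ax.
by have := H1 Ax; rewrite H2// eqxx.
Qed.

Lemma measurable_symdiff (f : Lp) : measurable (A `+` Lp_supp f).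
Proof.
by apply: measurableU; apply: measurableD => //; exact: measurable_Lp_supp.
Qed.

(** The restriction of [f] to [A] is a nonzero subvector, hence is [f] itself, which therefore
    vanishes off [A]. *)
Lemma subvector_atom_supp (f : Lp) : subvector_atom f -> full_on_atom f ->
  is_Lp_supp A f.
Proof.
move=> [_ atf] full; have [g gE] := restrict_Lp f mA.
have gf : g = f.
  case: (atf g); [by exists A| |by []] => g0; exfalso.
  apply: full_on_atom_not0 full _; apply: filterS2 g0 gE => x g0 gx Ax.
  by move: gx; rewrite g0 indicE mem_set// mulr1.
apply/measure0_aeP; first exact: measurable_symdiff.
rewrite gf in gE; apply: filterS2 full gE => x fx gx.
move=> [[Ax /negP]|[fx_neq0 nAx]]; first by rewrite fx.
by move: fx_neq0; rewrite /Lp_supp /= gx indicE memNset// mulr0 eqxx.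
Qed.

Lemma Lp_supp_unique (f g : Lp) : is_Lp_supp A f -> is_Lp_supp A g ->
  disjointly_supported f g -> False.
Proof.
move=> fA gA /disjointly_supportedP fg; apply: atom_not_null.
have full (h : Lp) : is_Lp_supp A h -> full_on_atom h.
  move=> /measure0_aeP => /(_ (measurable_symdiff h)).
  by apply: filterS => x Ahx Ax; apply: contra_notT Ahx => hx; left; split=> //; exact/negP.
apply: filterS3 fg (full _ fA) (full _ gA) => x H Hf Hg Ax.
by case: H => H; [have := Hf Ax|have := Hg Ax]; rewrite H eqxx.
Qed.

Definition branch (s : seq nat) : Prop := S s /\ full_on_atom (phi s).

Lemma branch_prefix (s t : seq nat) : branch t -> prefix s t -> branch s.
Proof.
move=> [St full] st; split; first exact: treeS St.
apply: filterS2 (ae_prefix St st) full => x H1 H2 Ax.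
by rewrite H1 ?H2.
Qed.

Lemma atom_indicator : exists f : Lp, {ae mu, forall x, (f x : R) = \1_A x}.
Proof.
apply: Lp_of_fun; first exact: measurable_indic.
rewrite /pint; under eq_integral => x _.
  rewrite (_ : _ `^ p = \1_A x); last first.
    rewrite indicE; case: (x \in A); first by rewrite normr1 powR1.
    by rewrite normr0 powR0// gt_eqF.
  over.
by rewrite integral_indic// setIT.
Qed.

(** Otherwise every [phi s], and with it the whole span, vanishes almost everywhere on [A], and the
    indicator of [A] cannot be approximated. *)
Lemma branch_root : branch [::].
Proof.
have [[s Bs]|noB] := pselect (exists s, branch s).
  exact: branch_prefix Bs (prefix0s _).
exfalso; apply: atom_not_null.
have null : {ae mu, forall x s, S s -> A x -> (phi s x : R) = 0}.
  apply: ae_forall_countable => s.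
  have [Ss|nSs] := pselect (S s); last by apply: aeW.
  have [|full] := atom_dichotomy (phi s); first by apply: filterS => x H _.
  by case: noB; exists s.
have [a aE] := atom_indicator.
have : {ae mu, forall x, (\1_A x : R) = 0}.
  apply: small_ae0; first exact: measurable_indic.
  move=> e e0; have [_ _ _ _ dense] := disint.
  have [l lS al] := dense a e e0; eexists; split; last exact: al.
    by apply: measurable_funB; [exact: measurable_Lp|exact: measurable_span].
  apply: filterS2 null aE => x phi0 ->; rewrite indicE.
  have [xA|_] := boolP (x \in A); last by rewrite normr0.
  rewrite big_seq big1 ?subr0// => s /lS Ss.
  by rewrite phi0 ?mulr0//; exact/set_mem.
apply: filterS => x + Ax; rewrite indicE mem_set// => /eqP.
by rewrite oner_eq0.
Qed.

(** Otherwise all partial sums over the children vanish on [A], where the error of summativity is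
    then [phi s] itself. *)
Lemma branch_child (s : seq nat) : branch s -> nonterminal S s ->
  exists n, branch (rcons s n).
Proof.
move=> [Ss full] [n0 Sn0]; have [//|noB] := pselect (exists n, branch (rcons s n)).
exfalso; apply: full_on_atom_not0 full _.
have null : {ae mu, forall x n, S (rcons s n) -> A x ->
    (phi (rcons s n) x : R) = 0}.
  apply: ae_foralln => n.
  have [Sn|nSn] := pselect (S (rcons s n)); last by apply: aeW.
  have [|full] := atom_dichotomy (phi (rcons s n)).
    by apply: filterS => x H _.
  by case: noB; exists n.
have : {ae mu, forall x, (phi s x : R) * \1_A x = 0}.
  apply: small_ae0.
    by apply: measurable_funM; [exact: measurable_Lp|exact: measurable_indic].
  move=> e e0; have [N _ small] := summative_approx Sn0 e0.
  eexists; split; last exact: small.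
    apply: measurable_funB; first exact: measurable_Lp.
    exact: measurable_partial_sum.
  apply: filterS null => x phi0; rewrite indicE.
  have [xA|_] := boolP (x \in A); last by rewrite mulr0 normr0.
  rewrite mulr1 big1 ?subr0// => n /set_mem Sn.
  by rewrite phi0//; exact/set_mem.
by apply: filterS => x + Ax; rewrite indicE mem_set// mulr1.
Qed.

Lemma branch_chain_full (C : set (seq nat)) (f : Lp) : is_chain S C ->
  is_chain_limit C f -> C `<=` branch -> full_on_atom f.
Proof.
move=> [[s0 Cs0] _ _] limf CB.
have : {ae mu, forall x s, C s -> A x -> (phi s x : R) != 0}.
  apply: ae_forall_countable => s.
  have [Cs|nCs] := pselect (C s); last by apply: aeW.
  by apply: filterS (CB _ Cs).2 => x H _.
apply: filterS2 limf => x [fD _] H Ax.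
have Dx : common_supp C x by move=> s Cs; exact: H.
by rewrite (fD Dx _ Cs0) H.
Qed.

(** * Loss of mass along the nodes that are nonzero on the atom *)

Local Notation mass s := (Lp_mass (phi s)).

(** The bound is the mass of the root vector restricted to [A], since every node of the branch
    agrees with the root there. *)
Lemma branch_mass : exists2 r : R, 0 < r & forall s, branch s -> r <= mass s.
Proof.
have [_ root_full] := branch_root.
have [g gE] := restrict_Lp (phi [::]) mA.
exists (Lp_mass g).
  rewrite lt0r Lp_mass_ge0 andbT; apply/eqP => /Lp_mass_eq0 g0.
  apply: full_on_atom_not0 root_full _; apply: filterS2 g0 gE => x g0 gx Ax.
  by move: gx; rewrite g0 indicE mem_set// mulr1.
move=> s [Ss s_full]; apply: Lp_mass_le.
apply: filterS3 gE s_full (ae_prefix Ss (prefix0s _)).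
move=> x -> H1 H2; rewrite indicE; have [xA|_] := boolP (x \in A).
  by rewrite mulr1 H2// H1//; exact/set_mem.
by rewrite mulr0 normr0.
Qed.

Lemma mass_prefix (s t : seq nat) : S t -> prefix s t -> mass t <= mass s.
Proof.
move=> St st; apply: Lp_mass_le.
apply: filterS (ae_prefix St st) => x H.
by have [->|/H ->] := eqVneq (phi t x : R) 0; rewrite ?normr0.
Qed.

Lemma mass_children (s : seq nat) (m n : nat) : m != n ->
  S (rcons s m) -> S (rcons s n) ->
  mass (rcons s m) + mass (rcons s n) <= mass s.
Proof.
move=> mn Sm Sn; apply: Lp_mass_add_le.
have [_ _ _ sep _] := disint.
have /disjointly_supportedP disj := sep _ _ Sm Sn (incomparable_rcons s mn).
apply: filterS3 disj (ae_child Sm) (ae_child Sn).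
move=> x H Hm Hn.
have zero : `|0 : R| `^ p = 0 by rewrite normr0 powR0// gt_eqF.
case: H => [m0|n0].
  rewrite m0 zero add0r; have [->|/Hn ->//] := eqVneq (phi (rcons s n) x : R) 0.
  by rewrite zero powR_ge0.
rewrite n0 zero addr0; have [->|/Hm ->//] := eqVneq (phi (rcons s m) x : R) 0.
by rewrite zero powR_ge0.
Qed.

(* rcons t' m is the first node of C beyond t outside the branch of A. *)
Lemma branch_departure (C : set (seq nat)) (t v : seq nat) :
  almost_norm_maximizing_chain S phi C -> C t -> C v -> branch t ->
  ~ branch v -> exists t' m, [/\ prefix t t', branch t',
    almost_norm_maximizing_child S phi t' m & ~ branch (rcons t' m)].
Proof.
move=> [[_ CS totC] maxC] Ct Cv Bt nBv.
have /prefixP[u vE] : prefix t v.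
  by have [//|vt] := totC _ _ Ct Cv; case: nBv; exact: branch_prefix Bt vt.
elim: u t Ct Bt vE => [|a u IH] t Ct Bt vE.
  by case: nBv; rewrite vE cats0.
have nt : nonterminal S t.
  exists a; apply: (treeS _ (CS _ Cv)).
  by rewrite vE -cat_rcons; exact: prefix_prefix.
have [m Ctm tm] := maxC t Ct nt.
have [Btm|nBtm] := pselect (branch (rcons t m)); last first.
  by exists t, m; split=> //; exact: prefix_refl.
have ma : m = a.
  have := totC _ _ Ctm Cv; rewrite vE -cats1 !prefix_catr// !prefix_cons.
  by rewrite !eqxx /=; case=> /andP[/eqP ->].
have vE' : v = rcons t m ++ u by rewrite ma cat_rcons.
have [t' [m' [tt' Bt' t'm' nB]]] := IH _ Ctm Btm vE'.
by exists t', m'; split=> //; exact: prefix_trans (prefix_rcons _ _) tt'.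
Qed.

Context (C : nat -> set (seq nat)).
Context (partC : partition [set: nat] C S).
Context (normC : forall n, almost_norm_maximizing_chain S phi (C n)).

(* For x and y the masses of siblings, x on the branch and y almost
   norm-maximizing, below nodes of masses z and w. *)
Lemma drop_bound (x y z w q r : R) : x <= y + q -> q <= r / 2 -> r <= x ->
  x + y <= z -> z <= w -> x + r / 2 <= w.
Proof. lra. Qed.

Lemma branch_absorbed : exists n, C n `<=` branch.
Proof.
have [//|noC] := pselect (exists n, C n `<=` branch); exfalso.
have leaves n : exists2 v, C n v & ~ branch v.
  have [//|no] := pselect (exists2 v, C n v & ~ branch v).
  case: noC; exists n => v Cv; apply: contrapT => nBv.
  by apply: no; exists v.
have inC s : S s -> exists n, C n s.
  by case: partC => <- _ _ [n _ Cs]; exists n.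
(* The chain through [t] leaves the branch at a proper extension of [t], so [t] is nonterminal and
   [branch_child] applies. *)
have grow t : branch t -> exists n, branch (rcons t n).
  move=> Bt; have [n Ct] := inC t Bt.1; have [v Cv nBv] := leaves n.
  apply: branch_child => //.
  have [t' [m [tt' Bt' [St'm _] _]]] := branch_departure (normC n) Ct Cv Bt nBv.
  have : prefix t (rcons t' m) by exact: prefix_trans tt' (prefix_rcons _ _).
  move=> /prefixP[[|a u] E].
    have := size_prefix tt'; move/(congr1 size): E.
    by rewrite cats0 size_rcons => <-; rewrite ltnn.
  by exists a; apply: treeS St'm; rewrite E -cat_rcons prefix_prefix.
have [r r0 rI] := branch_mass.
have step s : branch s -> exists2 t, branch t & mass t + r / 2 <= mass s.
  move=> Bs.
  (* From length [K] on, the slack allowed to an almost norm-maximizing child is at most [r / 2];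
     the branch is first followed that far. *)
  have [K rK] : exists K, 2^-1 ^+ K <= r / 2.
    exists (Num.bound (r / 2)^-1); set K := Num.bound _.
    rewrite exprVn -[leRHS]invrK lef_pV2 ?posrE ?invr_gt0 ?exprn_gt0 ?divr_gt0//.
    apply: ltW; apply: lt_trans (archi_boundP _) _.
      by rewrite invr_ge0 ltW// divr_gt0.
    by rewrite -natrX ltr_nat ltn_expl.
  have [t [Bt st szt]] : exists t, [/\ branch t, prefix s t & (K <= size t)%N].
    elim: (K) => [|j [t [Bt st szt]]]; first by exists s; rewrite prefix_refl.
    have [n Btn] := grow t Bt; exists (rcons t n).
    by rewrite size_rcons ltnS; split=> //; exact: prefix_trans st (prefix_rcons _ _).
  (* At [t'] the chain takes the child [m] off the branch, although the child [b] on the branch has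
     mass at least [r]. Hence [m] has mass at least [r / 2], which is missing from [b]. *)
  have [n Ct] := inC t Bt.1; have [v Cv nBv] := leaves n.
  have [t' [m [tt' Bt' [Sm am] nBm]]] := branch_departure (normC n) Ct Cv Bt nBv.
  have [b Bb] := grow t' Bt'; exists (rcons t' b) => //.
  have bm : b != m by apply: contra_notN nBm => /eqP <-.
  have := am b Bb.1; rewrite !Lp_norm_poweR.
  rewrite (Lp_massE (phi (rcons t' b))) (Lp_massE (phi (rcons t' m))).
  rewrite -EFinD lee_fin => Ibm.
  have small : 2^-1 ^+ size (rcons t' m) <= r / 2 :> R.
    apply: le_trans rK; apply: ler_wiXn2l.
    - by rewrite invr_ge0.
    - by rewrite invf_le1 ?ler1n.
    - by rewrite size_rcons ltnW// ltnS (leq_trans szt)// size_prefix.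
  exact: (drop_bound Ibm small (rI _ Bb) (mass_children bm Bb.1 Sm)
    (mass_prefix Bt'.1 (prefix_trans st tt'))).
have descent k : exists2 s, branch s & mass s + k%:R * (r / 2) <= mass [::].
  elim: k => [|k [s Bs Hs]].
    by exists [::]; rewrite ?mul0r ?addr0//; exact: branch_root.
  have [t Bt Ht] := step s Bs; exists t; first exact: Bt.
  have Hk := le_trans (lerD Ht (lexx (k%:R * (r / 2)))) Hs.
  rewrite -[k.+1]addn1 natrD mulrDl mul1r [_ * _ + _]addrC addrA; exact: Hk.
have r2 : 0 < r / 2 by rewrite divr_gt0.
(* So many losses of [r / 2] exceed the mass of the root, while masses are nonnegative. *)
have [s _] := descent (Num.bound (mass [::] / (r / 2))).
rewrite leNgt => /negP; apply.
have := archi_boundP (divr_ge0 (Lp_mass_ge0 (phi [::])) (ltW r2)).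
rewrite ltr_pdivrMr// => H; apply: lt_le_trans H _.
by rewrite lerDr Lp_mass_ge0.
Qed.

End Disintegrations.

Theorem theorem3p2 (d : measure_display) (T : measurableType d) (R : realType)
    (mu : {measure set T -> \bar R}) (p : R) (p1 : (1 <= p%:E)%E)
    (S : set (seq nat)) (phi : seq nat -> LspaceType mu p1) :
  is_tree S -> disintegration S phi ->
  (forall C : set (seq nat), almost_norm_maximizing_chain S phi C ->
    exists f : LspaceType mu p1,
      [/\ is_subvector_inf (phi @` C) f,
          Lp_is0 f \/ subvector_atom f
        & Lp_limit_along phi C f]) /\
  (forall C : nat -> set (seq nat),
    partition [set: nat] C S ->
    (forall n, almost_norm_maximizing_chain S phi (C n)) ->
    forall f : nat -> LspaceType mu p1,
    (forall n, is_subvector_inf (phi @` C n) (f n)) ->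
    (forall m n : nat, m <> n -> disjointly_supported (f m) (f n)) /\
    (forall A : set T, measure_atom mu A -> (mu A < +oo)%E ->
       exists! n : nat, is_Lp_supp A (f n))).
Proof.
move=> treeS disint; split.
  move=> C /almost_norm_maximizing_maximal maxC; have [chC _] := maxC.
  have [f limf] := chain_limit_exists treeS disint chC.
  exists f; split; first exact: chain_limit_inf chC limf.
    exact: (chain_limit_atom treeS disint maxC limf).
  exact: (chain_limit_Lp_limit treeS disint chC limf).
move=> C partC normC f inff.
have disj m n : m <> n -> disjointly_supported (f m) (f n).
  move=> mn; have CD0 : C m `&` C n = set0.
    have [_ trivC _] := partC; apply: contrapT => /eqP/set0P ne; apply: mn.
    exact: trivC.
  exact: (subvector_inf_disjoint treeS disint
    (almost_norm_maximizing_maximal (normC m))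
    (almost_norm_maximizing_maximal (normC n)) CD0 (inff m) (inff n)).
split=> // A atomA A_fin.
(* The infimum of a chain that stays on the branch is nonzero on [A], hence an atom of the subvector
   order, and its support is [A]. A second index would give a disjointly supported vector with the
   same support. *)
have [n CnB] := branch_absorbed treeS disint atomA A_fin partC normC.
have maxC := almost_norm_maximizing_maximal (normC n).
have limf := subvector_inf_chain_limit treeS disint maxC.1 (inff n).
have full := branch_chain_full maxC.1 limf CnB.
have fnA : is_Lp_supp A (f n).
  apply: subvector_atom_supp => //.
  have [f0|//] := chain_limit_atom treeS disint maxC limf; exfalso.
  by apply: (full_on_atom_not0 atomA full); apply: filterS f0 => x fx _.
exists n; split=> // m fmA; apply: contrapT => /disj.
exact: Lp_supp_unique fnA fmA.
Qed.
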